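(* Let $G=\mathbb F_2^{\,n}$, let $A\subseteq G$, let $k\ge2$ be an integer, and let $0<\alpha,\delta<1$ with $\alpha+\delta\le1$. Let $Q_k$ be a uniform coset-approximation bound for $k$-stable sets, as defined in the context. If $$\operatorname{dist}_G\bigl(A,\mathcal S_k(G)\bigr)\le\delta,$$ then $$\operatorname{reg}_{\sqrt{\alpha+\delta}}(\mathbf 1_A)\le Q_k(\alpha).$$ In particular, for $0<\rho<1$, $$\operatorname{reg}_\rho(\mathbf 1_A)>Q_k(\rho^2/2)\quad\Longrightarrow\quad\operatorname{dist}_G\bigl(A,\mathcal S_k(G)\bigr)>\frac{\rho^2}2.$$
   Context: Stability: a ladder of length $k$ in $A\subseteq G$ consists of $a_1,\dots,a_k,b_1,\dots,b_k\in G$ with $a_p+b_q\in A\iff p\le q$ for all $1\le p,q\le k$. $A$ is $k$-stable if it contains no ladder of length $k$; $\mathcal S_k(G)$ is the family of $k$-stable subsets of $G$. For a nonempty family $\mathcal C$ of subsets of $G$, $\operatorname{dist}_G(A,\mathcal C)=\min_{C\in\mathcal C}|A\triangle C|/|G|$. Uniform bound $Q_k$: for $k\ge2$ and $0<\alpha<1$, $Q_k(\alpha)$ denotes any number with the following property: every $k$-stable subset $A'$ of every finite elementary abelian $2$-group $\Gamma$ (i.e. $\Gamma\cong\mathbb F_2^{\,N}$ for some $N$) is within normalized edit distance $\alpha$ of a union of cosets of a subspace of index at most $Q_k(\alpha)$; that is, there are a subspace $H\le\Gamma$ with $[\Gamma:H]\le Q_k(\alpha)$ and a union $C$ of cosets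 of $H$ with $|A'\triangle C|\le\alpha|\Gamma|$. (Such bounds are known to exist from the literature; the proposition holds for any such choice.) Regularity: with $\langle u,v\rangle=\sum_ju_jv_j\in\mathbb F_2$, for a subspace $H\le G$, $f:G\to[0,1]$ and $x,t\in G$, put $\widehat f_{x+H}(t)=\frac1{|H|}\sum_{h\in H}f(x+h)(-1)^{\langle t,h\rangle}$. The coset $x+H$ is $\epsilon$-uniform for $f$ if $|\widehat f_{x+H}(t)|\le\epsilon$ for every $t\notin H^\perp$, where $H^\perp=\{y\in G:\langle y,h\rangle=0\ \forall h\in H\}$. $H$ is $\epsilon$-regular for $f$ if all but at most $\epsilon|G|$ points $x\in G$ lie in $\epsilon$-uniform cosets of $H$. $\operatorname{reg}_\epsilon(f)=\min\{2^{\operatorname{codim}H}:H\le G\text{ is }\epsilon\text{-regular for }f\}$. *)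

(* Defs.v *)
From HB Require Import structures.
From mathcomp Require Import all_boot all_order all_algebra.
From mathcomp Require Import reals.

Set Implicit Arguments.
Unset Strict Implicit.
Unset Printing Implicit Defensive.

Import Order.TTheory GRing.Theory Num.Theory.
Local Open Scope ring_scope.

Notation F2 n := 'rV['F_2]_n.

Section FiniteVspace.
Import VectorInternalTheory.
Variables (F : finFieldType) (V : vectType F).
HB.instance Definition _ := [Countable of {vspace V} by <:].
HB.instance Definition _ := [Finite of {vspace V} by <:].
End FiniteVspace.

Definition symdiff (T : finType) (A B : {set T}) : {set T} :=
  (A :\: B) :|: (B :\: A).

(* Ladders are indexed from 0 instead of 1. *)
Definition is_ladder n k (A : {set F2 n}) (a b : {ffun 'I_k -> F2 n}) : bool :=
  [forall p : 'I_k, forall q : 'I_k, (a p + b q \in A) == (p <= q)%N].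

Definition stable_sets n k : {set {set F2 n}} :=
  [set A | ~~ [exists a : {ffun 'I_k -> F2 n},
               exists b : {ffun 'I_k -> F2 n}, is_ladder A a b]].

(* The default value 1 bounds every normalized edit distance, so on a nonempty
   family this is the minimum over the family, see [edit_dist_attained]. *)
Definition edit_dist (R : realType) n (A : {set F2 n}) (CC : {set {set F2 n}})
    : R :=
  \big[Num.min/1]_(C in CC) (#|symdiff A C|%:R / #|{: F2 n}|%:R).

Definition vcoset n (H : {vspace F2 n}) (x : F2 n) : {set F2 n} :=
  [set x + h | h in H].

Definition vindex n (H : {vspace F2 n}) : nat :=
  #|[set vcoset H x | x : F2 n]|.

Definition union_of_cosets n (H : {vspace F2 n}) (C : {set F2 n}) : Prop :=
  exists X : {set F2 n}, C = \bigcup_(x in X) vcoset H x.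

(* The number [q] is an admissible value of Q_k(alpha). *)
Definition coset_approx_bound (R : realType) k (alpha q : R) : Prop :=
  forall N (A : {set F2 N}), A \in stable_sets N k ->
  exists (H : {vspace F2 N}) (C : {set F2 N}),
    [/\ (vindex H)%:R <= q, union_of_cosets H C &
        #|symdiff A C|%:R <= alpha * #|{: F2 N}|%:R].

Definition dot n (u v : F2 n) : 'F_2 := \sum_j u 0 j * v 0 j.

Definition perp n (H : {vspace F2 n}) : {set F2 n} :=
  [set y | [forall (h | h \in H), dot y h == 0]].

Definition coset_fourier (R : realType) n (f : F2 n -> R) (H : {vspace F2 n})
    (x t : F2 n) : R :=
  #|H|%:R^-1 * \sum_(h in H) f (x + h) * (-1) ^+ (dot t h : nat).

Definition uniform_coset (R : realType) n (eps : R) (f : F2 n -> R)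
    (H : {vspace F2 n}) (x : F2 n) : bool :=
  [forall (t | t \notin perp H), `|coset_fourier f H x t| <= eps].

Definition regular_subspace (R : realType) n (eps : R) (f : F2 n -> R)
    (H : {vspace F2 n}) : bool :=
  #|[set x | ~~ uniform_coset eps f H x]|%:R <= eps * #|{: F2 n}|%:R.

Definition codim n (H : {vspace F2 n}) : nat := (n - \dim H)%N.

(* The default value 2 ^ n is the one given by the zero subspace, which is
   regular as soon as eps >= 0, see [reg_attained]. *)
Definition reg (R : realType) n (eps : R) (f : F2 n -> R) : nat :=
  \big[minn/(2 ^ n)%N]_(H : {vspace F2 n} | regular_subspace eps f H)
    (2 ^ codim H)%N.

Definition indicator (R : realType) n (A : {set F2 n}) (x : F2 n) : R :=
  (x \in A)%:R.

Lemma set0_stable n k : (0 < k)%N -> set0 \in stable_sets n k.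
Proof.
case: k => // k _; rewrite inE; apply/existsP => -[a /existsP[b]].
by move=> /forallP/(_ ord0)/forallP/(_ ord0); rewrite inE.
Qed.

Lemma edit_dist_le (R : realType) n (A C : {set F2 n}) (CC : {set {set F2 n}}) :
  C \in CC ->
  edit_dist R A CC <= #|symdiff A C|%:R / #|{: F2 n}|%:R.
Proof. by move=> CCC; rewrite /edit_dist (bigD1 C) //= ge_min lexx. Qed.

Lemma edit_dist_attained (R : realType) n (A : {set F2 n}) (CC : {set {set F2 n}}) :
  CC != set0 ->
  exists2 C, C \in CC &
    edit_dist R A CC = #|symdiff A C|%:R / #|{: F2 n}|%:R.
Proof.
case/set0Pn => C0 C0CC.
have [//|dist1] : (exists2 C, C \in CC &
    edit_dist R A CC = #|symdiff A C|%:R / #|{: F2 n}|%:R)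
    \/ edit_dist R A CC = 1.
  rewrite /edit_dist; elim/big_rec: _ => [|C x CCC IH]; first by right.
  by rewrite /Num.min; case: ifP => _ //; left; exists C.
exists C0 => //; apply/le_anti/andP; split; first exact: edit_dist_le.
rewrite dist1 ler_pdivrMr ?mul1r ?ler_nat ?max_card //.
by rewrite ltr0n; apply/card_gt0P; exists 0.
Qed.

Lemma regular_subspace0 (R : realType) n (eps : R) (f : F2 n -> R) :
  0 <= eps -> regular_subspace eps f 0%VS.
Proof.
move=> eps0; rewrite /regular_subspace.
rewrite (_ : [set _ | _] = set0) ?cards0 ?mulr_ge0 //.
apply/setP => x; rewrite !inE; apply/negbTE; rewrite negbK.
apply/forall_inP => t /negP[]; rewrite inE; apply/forall_inP => h.
rewrite memv0 => /eqP ->; rewrite /dot big1 // => j _.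
by rewrite mxE mulr0.
Qed.

Lemma reg_le (R : realType) n (eps : R) (f : F2 n -> R) H :
  regular_subspace eps f H -> (reg eps f <= 2 ^ codim H)%N.
Proof.
move=> regH; rewrite /reg; have: H \in index_enum {vspace F2 n}.
  exact: mem_index_enum.
elim: (index_enum _) => [//|H' s IH]; rewrite inE big_cons.
case/predU1P => [<-|/IH le_s]; first by rewrite regH geq_minl.
by case: ifP => // _; rewrite (leq_trans (geq_minr _ _)).
Qed.

Lemma reg_attained (R : realType) n (eps : R) (f : F2 n -> R) : 0 <= eps ->
  exists2 H, regular_subspace eps f H & reg eps f = (2 ^ codim H)%N.
Proof.
move=> eps0; rewrite /reg; elim/big_rec: _ => [|H x regH [H' regH' ->]].
  exists 0%VS; first exact: regular_subspace0.
  by rewrite /codim dimv0 subn0.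
by rewrite /minn; case: ifP => _; [exists H | exists H'].
Qed.

(* Main.v *)
(** If [C] is a union of cosets of [H], then on each coset of [H] the function
    [1_C] is constant, so its nontrivial Fourier coefficients there vanish.
    Hence those of [1_A] on [x + H] are at most the density of the symmetric
    difference [D] of [A] and [C] on [x + H]. Averaging over [x], the points in
    cosets where this density exceeds [eps] make up at most a fraction
    [|D| / (eps |G|)] of [G]. Taking for [C] the coset approximation of a stable
    set at distance at most [delta] from [A], the density of [D] in [G] is at
    most [alpha + delta = eps ^ 2], so that [H] is [eps]-regular. *)

Require Import Defs.
From mathcomp Require Import all_boot all_order all_algebra.
From mathcomp Require Import reals.

Set Implicit Arguments.
Unset Strict Implicit.
Unset Printing Implicit Defensive.

Import Order.TTheory GRing.Theory Num.Theory.
Local Open Scope ring_scope.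

Lemma card_symdiff_triangle (T : finType) (A B C : {set T}) :
  (#|symdiff A C| <= #|symdiff A B| + #|symdiff B C|)%N.
Proof.
apply: leq_trans (leq_card_setU _ _); apply: subset_leq_card.
apply/subsetP => x; rewrite /symdiff !inE.
by case: (x \in A); case: (x \in B); case: (x \in C).
Qed.

Lemma card_F2 n : #|{: F2 n}| = (2 ^ n)%N.
Proof. by rewrite card_mx card_Fp // mul1n. Qed.

Lemma vspace_card_le n (H : {vspace F2 n}) : (#|H| <= 2 ^ \dim H)%N.
Proof.
pose comb (u : {ffun 'I_(\dim H) -> 'F_2}) : F2 n :=
  \sum_i u i *: (vbasis H)`_i.
have sub : H \subset [set comb u | u in [set: {ffun 'I_(\dim H) -> 'F_2}]].
  apply/subsetP => v vH; apply/imsetP.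
  exists [ffun i => coord (vbasis H) i v] => //.
  rewrite {1}(coord_vbasis vH) /comb.
  by apply: eq_bigr => i _; rewrite ffunE.
apply: leq_trans (subset_leq_card sub) _.
apply: leq_trans (leq_imset_card _ _) _.
by rewrite cardsT card_ffun card_Fp // card_ord.
Qed.

(** The cosets cover the space and each has at most [2 ^ \dim H] points. This passes from the index,
    bounded by [coset_approx_bound], to the power of two minimized in [reg]. *)
Lemma expn_codim_le_vindex n (H : {vspace F2 n}) : (2 ^ codim H <= vindex H)%N.
Proof.
have dimH : (\dim H <= n)%N.
  by have := dimvS (subvf H); rewrite dimvf /dim /= mul1n.
have cover_cosets : cover [set vcoset H x | x : F2 n] = [set: F2 n].
  apply/setP => x; rewrite inE; apply/bigcupP; exists (vcoset H x).
    exact: imset_f.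
  by apply/imsetP; exists 0; rewrite ?mem0v ?addr0.
have: (2 ^ n <= vindex H * 2 ^ \dim H)%N.
  rewrite -card_F2 -cardsT -cover_cosets.
  apply: leq_trans (leq_card_cover _) _; rewrite /vindex -sum_nat_const.
  apply: leq_sum => _ /imsetP[x _ ->].
  exact: leq_trans (leq_imset_card _ _) (vspace_card_le H).
by rewrite -{1}(subnK dimH) expnD leq_pmul2r ?expn_gt0.
Qed.

Lemma dotD n (t u v : F2 n) : dot t (u + v) = dot t u + dot t v.
Proof.
by rewrite /dot -big_split; apply: eq_bigr => j _; rewrite mxE mulrDr.
Qed.

Lemma sum_character_eq0 (R : realType) n (H : {vspace F2 n}) (t : F2 n) :
  t \notin perp H -> \sum_(h in H) (-1) ^+ (dot t h : nat) = 0 :> R.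
Proof.
rewrite inE negb_forall_in => /exists_inP[h0 h0H dot_h0].
set S := \sum_(h in H) _.
(* Translation by [h0] reverses the sign of every term. *)
suff /eqP : S = - S by rewrite eq_sym eqNr => /eqP.
rewrite {1}/S (reindex_inj (addIr h0)) /= -sumrN.
rewrite (eq_bigl (mem H)) => [|h]; last exact: rpredDr.
apply: eq_bigr => h _; rewrite dotD.
case: (dot t h0) dot_h0 => [[|[|//]] //= ?] _.
by case: (dot t h) => [[|[|//]] //= ?]; rewrite ?expr0 ?expr1 ?opprK.
Qed.

Lemma mem_union_of_cosets n (H : {vspace F2 n}) (C : {set F2 n}) x h :
  union_of_cosets H C -> h \in H -> (x + h \in C) = (x \in C).
Proof.
case=> X -> hH; apply/bigcupP/bigcupP => -[y yX /imsetP[g gH def_x]].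
  exists y => //; apply/imsetP; exists (g - h); first exact: rpredB.
  by rewrite addrA -def_x addrK.
by exists y => //; apply/imsetP; exists (g + h); rewrite ?rpredD // def_x addrA.
Qed.

Lemma vspace_card_gt0 n (H : {vspace F2 n}) : (0 < #|H|)%N.
Proof. by apply/card_gt0P; exists 0; apply: mem0v. Qed.

Lemma coset_fourier_le_symdiff (R : realType) n (A C : {set F2 n})
    (H : {vspace F2 n}) (x t : F2 n) :
  union_of_cosets H C -> t \notin perp H ->
  `|coset_fourier (@indicator R n A) H x t| <=
    #|H|%:R^-1 * \sum_(h in H) (x + h \in symdiff A C)%:R.
Proof.
move=> HC tH; rewrite /coset_fourier normrM ger0_norm ?invr_ge0 //.
rewrite ler_wpM2l ?invr_ge0 //.
(* The constant value of [1_C] on [x + H] factors out of a vanishing character sum. *)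
have C0 : \sum_(h in H) indicator R C (x + h) * (-1) ^+ (dot t h : nat) = 0.
  under eq_bigr => h hH do rewrite /indicator (mem_union_of_cosets x HC hH).
  by rewrite -mulr_sumr sum_character_eq0 ?mulr0.
(* Subtracting this zero replaces [1_A] by [1_A - 1_C], whose absolute value is the indicator of
   [symdiff A C]. *)
rewrite -[X in `|X|]subr0 -[X in _ - X]C0 -sumrB.
apply: le_trans (ler_norm_sum _ _ _) _; apply: ler_sum => h _.
rewrite -mulrBl normrM normrX normrN1 expr1n mulr1 /indicator /symdiff !inE.
by case: (_ \in A); case: (_ \in C);
  rewrite ?subrr ?subr0 ?sub0r ?normrN ?normr0 ?normr1.
Qed.

Lemma regular_of_union_of_cosets (R : realType) n (A C : {set F2 n})
    (H : {vspace F2 n}) (eps : R) :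
  0 < eps -> union_of_cosets H C ->
  #|symdiff A C|%:R <= eps ^+ 2 * #|{: F2 n}|%:R ->
  regular_subspace eps (@indicator R n A) H.
Proof.
move=> eps0 HC leAC; rewrite /regular_subspace; set B := [set x | _].
have H0 : 0 < #|H|%:R :> R by rewrite ltr0n vspace_card_gt0.
have dens x : x \in B ->
    eps * #|H|%:R <= \sum_(h in H) (x + h \in symdiff A C)%:R.
  rewrite inE negb_forall_in => /exists_inP[t tH]; rewrite -ltNge => /ltW lt.
  by rewrite -ler_pdivlMr // mulrC (le_trans lt) ?coset_fourier_le_symdiff.
(* Double counting: for each fixed [h], translation by [h] permutes the space, so [h] contributes
   [#|symdiff A C|]. *)
have sum_dens :
    \sum_x \sum_(h in H) (x + h \in symdiff A C)%:R
      = #|H|%:R * #|symdiff A C|%:R :> R.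
  rewrite exchange_big /= mulr_natl -sumr_const; apply: eq_bigr => h _.
  rewrite (reindex_inj (addIr (- h))) /=.
  under eq_bigr do rewrite subrK.
  by rewrite -natr_sum -sum1_card [in RHS]big_mkcond.
(* Markov's inequality: the nonnegative terms outside [B] are dropped. *)
have leB : #|B|%:R * (eps * #|H|%:R) <= #|H|%:R * #|symdiff A C|%:R.
  rewrite -sum_dens mulr_natl -sumr_const.
  apply: le_trans (ler_sum _ dens) _.
  rewrite [leRHS](bigID (mem B)) /= lerDl.
  by apply: sumr_ge0 => x _; apply: sumr_ge0 => h _; apply: ler0n.
(* Cancelling [#|H|] and one of the two factors [eps] on the right leaves [#|B| <= eps * #|G|];
   hence the square root in the theorem. *)
have := le_trans leB (ler_wpM2l (ltW H0) leAC).
by rewrite mulrA mulrC ler_pM2l // mulrC expr2 -mulrA ler_pM2l.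
Qed.

Lemma reg_le_coset_approx_bound (R : realType) n (A : {set F2 n}) k
    (alpha delta q : R) :
  (0 < k)%N -> 0 < alpha + delta -> coset_approx_bound k alpha q ->
  edit_dist R A (stable_sets n k) <= delta ->
  (reg (Num.sqrt (alpha + delta)) (@indicator R n A))%:R <= q.
Proof.
move=> k0 ad0 hq.
(* The empty set is stable since [0 < k], so the distance is a true minimum, attained at some
   [A']. *)
have CC0 : stable_sets n k != set0.
  by apply/set0Pn; exists set0; apply: set0_stable.
have [A' A'stable ->] := edit_dist_attained R A CC0.
have G0 : 0 < #|{: F2 n}|%:R :> R by rewrite card_F2 ltr0n expn_gt0.
rewrite ler_pdivrMr // => AA'.
have [H [C [Hq HC A'C]]] := hq _ _ A'stable.
apply: le_trans Hq; rewrite ler_nat.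
apply: leq_trans (expn_codim_le_vindex H); apply: reg_le.
apply: (regular_of_union_of_cosets _ HC); first by rewrite sqrtr_gt0.
rewrite sqr_sqrtr; last exact: ltW.
rewrite mulrDl addrC.
(* Triangle inequality through [A']: [delta] from [A] to [A'], then [alpha] from [A'] to [C]. *)
apply: le_trans (lerD AA' A'C).
by rewrite -natrD ler_nat card_symdiff_triangle.
Qed.

Theorem proposition6p3 (R : realType) (n : nat) (A : {set F2 n}) (k : nat)
    (hk : (2 <= k)%N) (Q : R -> R)
    (hQ : forall alpha : R, 0 < alpha < 1 ->
            coset_approx_bound k alpha (Q alpha)) :
  (forall alpha delta : R, 0 < alpha < 1 -> 0 < delta < 1 ->
     alpha + delta <= 1 ->
     edit_dist R A (stable_sets n k) <= delta ->
     (reg (Num.sqrt (alpha + delta)) (@indicator R n A))%:R <= Q alpha)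
  /\
  (forall rho : R, 0 < rho < 1 ->
     Q (rho ^+ 2 / 2) < (reg rho (@indicator R n A))%:R ->
     rho ^+ 2 / 2 < edit_dist R A (stable_sets n k)).
Proof.
have k0 : (0 < k)%N by apply: leq_trans hk.
split=> [alpha delta alpha01 /andP[delta0 _] _ dist|rho /andP[rho0 rho1]].
  apply: reg_le_coset_approx_bound (hQ _ alpha01) dist => //.
  by case/andP: alpha01 => alpha0 _; apply: addr_gt0.
have rho2_gt0 : 0 < rho ^+ 2 by rewrite exprn_gt0.
have half01 : 0 < rho ^+ 2 / 2 < 1.
  rewrite divr_gt0 //= ltr_pdivrMr // mul1r (@lt_trans _ _ 1) ?ltr1n //.
  by rewrite expr_lt1 // ltW.
(* Contrapositive, with [alpha] and [delta] both equal to [rho ^+ 2 / 2], so that their sum has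
   square root [rho]. *)
rewrite !ltNge; apply: contra => dist.
have rhoE : rho = Num.sqrt (rho ^+ 2 / 2 + rho ^+ 2 / 2).
  by rewrite -splitr sqrtr_sqr gtr0_norm.
rewrite {1}rhoE; apply: reg_le_coset_approx_bound (hQ _ half01) dist => //.
by rewrite -splitr.
Qed.
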